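(* Let $\Lambda={+}{-}$ be the signature of the tent map and let $n\ge3$. Then $$\frac12 I_n(\Sigma_\Lambda)\ \le\ |\operatorname{Allow}_n(\Sigma_\Lambda)|\ \le\ \frac12 I_n(\Sigma_\Lambda)+\sum_{c=1}^{\lfloor\frac{n-1}{2}\rfloor}2^{\,n-2c-1}\,\overline{\psi}_2(c),$$ where $I_n(\Sigma_\Lambda)$ is the number of pairs $(\pi,E)$ with $\pi\in\operatorname{Allow}_n(\Sigma_\Lambda)$ and $E$ a valid $\Lambda$-segmentation of $\hat\pi^\star$, and $\overline{\psi}_2(c)$ is the number of primitive binary words of length $c$ with an odd number of ones.
   Context: **Shift.** Let $\mathcal{W}_2$ be the set of infinite words on $\{0,1\}$. The order $<_\Lambda$: for $v\ne w$ with first difference at position $j$, if the number of $i<j$ with $v_i=1$ is even, then $v<_\Lambda w$ iff $v_j<w_j$; if odd, then $v<_\Lambda w$ iff $v_j>w_j$. $\Sigma_\Lambda(w_1w_2w_3\cdots)=w_2w_3\cdots$. $\operatorname{Allow}_n(\Sigma_\Lambda)$ is the set of $\pi\in\mathcal{S}_n$ such that for some $w\in\mathcal{W}_2$ the words $w_iw_{i+1}\cdots$ ($1\le i\le n$) are distinct and in the same relative order under $<_\Lambda$ as $\pi_1,\dots,\pi_n$. **Primitive words.** A finite word is primitive if it is not of the form $a^m$ with $m>1$. One has $\overline{\psi}_2(m)=\frac12\sum_{d\mid m,\ d\text{ odd}}\mu(d)2^{m/d}$ with $\mu$ the Möbius function. **Marked cycle.** $\hat\pi^\star=\hat\pi^\star_1\cdots\hat\pi^\star_n$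 is defined by $\hat\pi^\star_{\pi_i}=\pi_{i+1}$ for $1\le i\le n-1$ and $\hat\pi^\star_{\pi_n}=\star$ (a symbol). A block is increasing (decreasing) if it is so after deleting $\star$, if present. **$\Lambda$-segmentation.** A triple $E=(e_0,e_1,e_2)$ of integers with $0=e_0\le e_1\le e_2=n$ such that $\hat\pi^\star_1\cdots\hat\pi^\star_{e_1}$ is increasing, $\hat\pi^\star_{e_1+1}\cdots\hat\pi^\star_n$ is decreasing, $e_1=0$ if $\pi_{n-1}\pi_n=21$, and $e_1\ne\pi_n$. Its associated prefix is $\zeta=z_1\cdots z_{n-1}$ with $z_i=0$ if $\pi_i\le e_1$ and $z_i=1$ otherwise. If $\pi_n\ne n$, let $x$ be such that $\pi_x=\pi_n+1$ and $p=z_x\cdots z_{n-1}$; if $\pi_n\ne1$, let $y$ be such that $\pi_y=\pi_n-1$ and $q=z_y\cdots z_{n-1}$. The segmentation is invalid if $\pi_n\notin\{1,n\}$ and ($p=q^2$ or $q=p^2$); otherwise it is valid. The paper records that $I_n(\Sigma_\Lambda)=\sum_{i=1}^{n-1}2^{n-i-1}\psi_2(i)+2^{n-2}$, where $\psi_2(i)$ is the number of primitive binary words of length $i$. *)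

(* Defs.v *)
From mathcomp Require Import all_boot all_order all_algebra all_fingroup.
From mathcomp Require Import boolp.

Set Implicit Arguments.
Unset Strict Implicit.
Unset Printing Implicit Defensive.

(* The letters 0 and 1 are false and true; the word w_1 w_2 w_3 ... is the     *)
(* function sending i to w_(i+1).                                             *)
Definition word2 := nat -> bool.

Definition shift2 (w : word2) : word2 := fun i => w i.+1.

Definition tent_lt (v w : word2) : Prop :=
  exists j : nat,
    [/\ forall i, i < j -> v i = w i,
        v j <> w j &
        if odd (\sum_(i < j) v i) then w j < v j else v j < w j].

(* Only the relative order of the entries of pi matters here, so the 0-based  *)
(* indices and values of 'S_n are used directly.                              *)
Definition allowed n (pi : 'S_n) : Prop :=
  exists w : word2,
    (forall i j : 'I_n, i <> j -> iter i shift2 w <> iter j shift2 w) /\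
    (forall i j : 'I_n,
        tent_lt (iter i shift2 w) (iter j shift2 w) <-> pi i < pi j).

Definition Allow n : {set 'S_n} := [set pi : 'S_n | `[< allowed pi >]].

(* A nonempty word is a power of itself with exponent 1; the empty word is    *)
(* not primitive, being a ^ 2 for a empty.                                    *)
Definition wpower (a : seq bool) (m : nat) : seq bool := flatten (nseq m a).

Definition primitive_word (u : seq bool) : Prop :=
  ~ exists (a : seq bool) (m : nat), 1 < m /\ u = wpower a m.

Definition psi_odd (c : nat) : nat :=
  #|[set u : c.-tuple bool | `[< primitive_word u >] & odd (count_mem true u)]|.

Section Segmentation.
Variables (n : nat) (pi : 'S_n).

(* From here on indices and values are 1-based: entry i is pi_i for           *)
(* 1 <= i <= n, and position v is the i with pi_i = v for 1 <= v <= n.        *)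
Definition oneline : seq nat := [seq (pi k : nat).+1 | k <- enum 'I_n].
Definition entry (i : nat) : nat := nth 0 oneline i.-1.
Definition position (v : nat) : nat := (index v oneline).+1.

(* None is the symbol star. *)
Definition marked_cycle : seq (option nat) :=
  [seq (if position v < n then Some (entry (position v).+1) else None)
     | v <- iota 1 n].

(* pmap id deletes the star. *)
Definition increasing_block (b : seq (option nat)) : bool :=
  sorted ltn (pmap id b).
Definition decreasing_block (b : seq (option nat)) : bool :=
  sorted gtn (pmap id b).

(* The chain 0 = e0 <= e1 <= e2 = n confines the entries to {0, ..., n}, so    *)
(* triples over 'I_n.+1 lose nothing and make the pairs (pi, E) a finite type. *)
Definition segm : Type := ('I_n.+1 * 'I_n.+1 * 'I_n.+1)%type.

Definition segmentation (E : segm) : bool :=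
  let: (e0, e1, e2) := E in
  [&& e0 == 0 :> nat, e0 <= e1, e1 <= e2, e2 == n :> nat,
      increasing_block (take e1 marked_cycle),
      decreasing_block (drop e1 marked_cycle),
      (entry n.-1 == 2) && (entry n == 1) ==> (e1 == 0 :> nat) &
      e1 != entry n :> nat].

Definition zeta (E : segm) : seq bool :=
  let: (e0, e1, e2) := E in [seq e1 < entry i | i <- iota 1 n.-1].

(* z_i ... z_(n-1) *)
Definition zeta_from (E : segm) (i : nat) : seq bool := drop i.-1 (zeta E).

Definition invalid (E : segm) : bool :=
  let p := zeta_from E (position (entry n).+1) in
  let q := zeta_from E (position (entry n).-1) in
  [&& entry n != 1, entry n != n & (p == wpower q 2) || (q == wpower p 2)].

Definition valid_segmentation (E : segm) : bool :=
  segmentation E && ~~ invalid E.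

End Segmentation.

Definition I_ (n : nat) : nat :=
  #|[set x : 'S_n * segm n | x.1 \in Allow n & valid_segmentation x.1 x.2]|.

(* Main.v *)
Require Import Defs.
From mathcomp Require Import all_boot all_order all_algebra all_fingroup.
From mathcomp Require Import boolp zify.

(** Count the pairs (pi, E) with pi allowed and E a segmentation, valid or not.

    Every allowed pi has exactly two segmentations
    ([card_segmentation_allowed]).  The marked cycle without its star is a
    sequence of distinct numbers that increases and then decreases, so the cut between its two parts can be put just before or just
    after the largest entry, and nowhere else; the star does not add a third
    cut because e1 = pi_n is excluded.  That a cut exists is read off a word w
    inducing pi: the shift preserves the tent order on words starting with 0
    and reverses it on those starting with 1, so one may cut after the last
    value taken at a letter 0.  That pi never ends in 21 also comes from w,
    because v < 0v holds for no word v ([word_not21]).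
    Hence 2 |Allow_n| = I_n + J, where J counts the pairs with E invalid, and
    the lower bound is J >= 0.

    For the upper bound it suffices that J is at most twice the sum
    ([card_invalid]).  If E is invalid, its prefix zeta ends in a square qq
    whose two halves start at the positions n - 2c and n - c, c = |q|, and
    pi_(n-2c), pi_n, pi_(n-c) are consecutive integers, in this or in the
    reverse order.  As long as zeta has equal letters at i and j, the order of
    pi_i and pi_j passes to pi_(i+1) and pi_(j+1), reversed at each letter 1.
    This has three consequences.
    - q has an odd number of ones ([coding_odd]), as reading q from n - 2c and
      from n - c must reverse the order.
    - q is primitive ([coding_primitive]).  If q = a^m, reading a reverses the
      order, hence reading aa preserves it, so that pi is monotone along the
      positions n, n - 2|a|, n - 4|a|, ..., n - 2m|a| = n - 2c; as the first and
      last of these have adjacent values, m = 1.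
    - zeta, c and the side of pi_n on which pi_(n-c) lies determine pi
      ([coding_rigid]).  Two permutations that disagree on a pair of positions
      disagree on the pairs obtained by moving along zeta, hence on some pair
      (k, n), hence on (k, n - c), because n and n - c have adjacent values.
      Going on in this way produces a nontrivial rotation fixing q,
      which primitivity forbids.  Finally zeta and pi determine e1.
    So, for each c and each of the two sides, at most 2^(n-1-2c) times the
    number of admissible q pairs arise. *)

Set Implicit Arguments.
Unset Strict Implicit.
Unset Printing Implicit Defensive.

(** * Powers of words *)

Lemma count_wpower a m : count_mem true (wpower a m) = m * count_mem true a.
Proof. by rewrite /wpower count_flatten map_nseq sumn_nseq mulnC. Qed.

Lemma size_wpower a m : size (wpower a m) = m * size a.
Proof. by rewrite /wpower size_flatten /shape map_nseq sumn_nseq mulnC. Qed.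

Lemma wpowerD a m k : wpower a (m + k) = wpower a m ++ wpower a k.
Proof. by rewrite /wpower nseqD flatten_cat. Qed.

(** Induction on the lengths: the shorter word is a prefix of the longer one,
    and commutes with what is left after removing it. *)
Lemma commuting_words_power (u v : seq bool) : u ++ v = v ++ u ->
  exists a i j, u = wpower a i /\ v = wpower a j.
Proof.
have [k] := ubnP (size u + size v); elim: k u v => // k IH u v.
wlog uv : u v / size u <= size v.
  move=> H hk E; case/orP: (leq_total (size u) (size v)) => h; first exact: H.
  have [||a [i [j [-> ->]]]] := H v u h; [by rewrite addnC|by []|].
  by exists a, j, i.
move=> hk E; have [->|u0] := eqVneq u [::]; first by exists v, 0, 1; rewrite /wpower /= cats0.
have Ev : v = u ++ drop (size u) v.
  have := congr1 (take (size u)) E; rewrite take_size_cat// takel_cat// => Eu.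
  by rewrite {1}Eu cat_take_drop.
set v' := drop _ _ in Ev.
have E' : u ++ v' = v' ++ u.
  by move: E; rewrite Ev -catA => /eqP; rewrite eqseq_cat// => /andP[_ /eqP].
have [|a [i [j [uE vE]]]] := IH u v' _ E'.
  have : 0 < size u by rewrite lt0n size_eq0.
  by move: hk; rewrite Ev size_cat /=; lia.
by exists a, i, (i + j); rewrite wpowerD -uE -vE.
Qed.

(** This is used with v ++ u a rotation of u ++ v: a primitive word differs from
    all its nontrivial rotations. *)
Lemma commuting_not_primitive (u v : seq bool) : u ++ v = v ++ u ->
  u <> [::] -> v <> [::] -> ~ primitive_word (u ++ v).
Proof.
move=> /commuting_words_power[a [[|i] [[|j] [-> ->]]]] // _ _; apply.
by exists a, (i.+1 + j.+1); rewrite wpowerD; split; first by lia.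
Qed.

(** * Sequences coded by binary words *)

(** The values f 0, ..., f N behave along the letters z 0, ..., z (N - 1) as an
    orbit of the tent map does along its itinerary: letters 0 occur at smaller
    values than letters 1, and moving one step keeps the order at 0 and
    reverses it at 1.  Both a segmentation (where z i says that f i lies above
    the cut) and a word inducing a permutation give such a coding. *)
Definition coding N (f : nat -> nat) (z : nat -> bool) : Prop :=
  forall i j, i < N -> j < N -> f i < f j ->
    z i <= z j /\
    (z i = z j -> if z i then f j.+1 < f i.+1 else f i.+1 < f j.+1).

Lemma eq_coding N f z z' : (forall i, i < N -> z i = z' i) -> coding N f z -> coding N f z'.
Proof. by move=> zE cod i j iN jN fij; rewrite -!zE//; apply: cod. Qed.

Definition reads (z : nat -> bool) (u : seq bool) (i : nat) : Prop :=
  forall s, s < size u -> z (i + s) = nth false u s.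

Lemma reads_cat z u v i : reads z (u ++ v) i <-> reads z u i /\ reads z v (i + size u).
Proof.
split=> [r|[ru rv] s].
  split=> s su.
    by rewrite r ?size_cat ?nth_cat ?su //; lia.
  rewrite -addnA r ?size_cat ?nth_cat; last by lia.
  by rewrite ltnNge leq_addr /= addKn.
rewrite size_cat nth_cat => su; case: ltnP => h; first exact: ru.
by rewrite -rv -?addnA ?subnKC//; lia.
Qed.

Lemma reads_wpower z a m i k : reads z (wpower a m) i -> k < m ->
  reads z a (i + k * size a).
Proof.
move=> + km; have -> : m = k + 1 + (m - k.+1) by lia.
rewrite !wpowerD => /reads_cat[/reads_cat[_]]; rewrite size_wpower.
by rewrite /wpower /= cats0.
Qed.

Section Coding.
Variables (N : nat) (f : nat -> nat).
Hypothesis f_inj : forall i j, i <= N -> j <= N -> f i = f j -> i = j.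

Lemma ltn_total_inj i j : i <= N -> j <= N -> i <> j -> f i < f j \/ f j < f i.
Proof.
move=> iN jN ij; case: (ltngtP (f i) (f j)) => [||/(f_inj iN jN)//]; auto.
Qed.

(** Call a cut any e such that (e < f i) codes f.  One cut forces the steps
    f i -> f (i + 1) to increase below f i0 and to decrease above it, where i0 is
    the position before the maximum; so the value f i0 may be put on either
    side of the cut. *)
Lemma coding_cut_peak e i0 : coding N f (fun i => e < f i) -> i0 < N ->
  (forall i, i < N -> f i.+1 <= f i0.+1) ->
  forall e', e' = f i0 \/ e' < f i0 /\ (forall i, i < N -> e' < f i -> f i0 <= f i) ->
  coding N f (fun i => e' < f i).
Proof.
move=> cod i0N max e' ee'.
have strict i : i < N -> i <> i0 -> f i.+1 < f i0.+1.
  move=> iN ii0; rewrite ltn_neqAle max// andbT; apply/eqP.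
  by move=> /(f_inj iN i0N) [].
have inc i j : i < N -> j < N -> f i < f j -> f j <= f i0 -> f i.+1 < f j.+1.
  move=> iN jN fij fj; have [_] := cod i j iN jN fij.
  case: (ltnP e (f j)) => ej; last by rewrite ltnNge (leq_trans (ltnW fij) ej) => /(_ erefl).
  move=> _; have [jE|/eqP ji0] := eqVneq j i0.
    by rewrite jE; apply: strict => // iE; rewrite iE jE ltnn in fij.
  have fji : f j < f i0.
    rewrite ltn_neqAle fj andbT; apply/eqP.
    by move=> /(f_inj (ltnW jN) (ltnW i0N)).
  have [_] := cod j i0 jN i0N fji.
  rewrite ej (ltn_trans ej fji) => /(_ erefl).
  by have := max j jN; lia.
have dec i j : i < N -> j < N -> f i < f j -> f i0 <= f i -> f j.+1 < f i.+1.
  move=> iN jN fij fi; have [_] := cod i j iN jN fij.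
  case: (ltnP e (f i)) => ei; first by rewrite (ltn_trans ei fij) => /(_ erefl).
  move=> _; have [iE|/eqP ii0] := eqVneq i i0.
    by rewrite iE; apply: strict => // jE; rewrite iE jE ltnn in fij.
  have fii : f i0 < f i.
    rewrite ltn_neqAle fi andbT; apply/eqP.
    by move=> /(f_inj (ltnW i0N) (ltnW iN)) E; apply: ii0.
  have [_] := cod i0 i i0N iN fii.
  rewrite !ltnNge ei (leq_trans (ltnW fii) ei) => /(_ erefl) /=.
  by have := max i iN; lia.
move=> i j iN jN fij; split; first by lia.
have [/= ei _|/= ei ej] := boolP (e' < f i).
  apply: dec => //; case: ee' => [<-|[_]]; [exact: ltnW | exact].
apply: inc => //; move/esym/negbT: ej => ej.
by case: ee' => [|[]]; lia.
Qed.

(** The values b and c lie above a and are at most c, so the steps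
    starting from them should both reverse and preserve their order; as neither
    of them is the last value f N, both steps exist. *)
Lemma no_three_cuts a b c :
  (forall v, 0 < v <= N.+1 -> exists2 i, i <= N & f i = v) ->
  a < b -> b < c -> c <= N.+1 -> b <> f N -> c <> f N ->
  coding N f (fun i => a < f i) -> coding N f (fun i => c < f i) -> False.
Proof.
move=> surj ab bc cN bN cN' coda codc.
have [|i iN fi] := surj b; first by lia.
have [|j jN fj] := surj c; first by lia.
have iN' : i < N by rewrite ltn_neqAle iN andbT; apply/eqP => E; apply: bN; rewrite -E fi.
have jN' : j < N by rewrite ltn_neqAle jN andbT; apply/eqP => E; apply: cN'; rewrite -E fj.
have fij : f i < f j by rewrite fi fj.
have [_] := coda i j iN' jN' fij; have [_] := codc i j iN' jN' fij.
have -> : (a < f i) = true by lia.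
have -> : (a < f j) = true by lia.
have -> : (c < f i) = false by lia.
have -> : (c < f j) = false by lia.
by move=> /(_ erefl) + /(_ erefl); lia.
Qed.

Lemma coding_reads z u i j : coding N f z -> i + size u <= N -> j + size u <= N ->
  reads z u i -> reads z u j -> f i < f j ->
  if odd (count_mem true u) then f (j + size u) < f (i + size u)
  else f (i + size u) < f (j + size u).
Proof.
move=> cod; elim: u i j => [|b u IH] i j; first by rewrite /= !addn0.
rewrite /= !addnS -!addSn => iN jN ri rj fij.
have zi : z i = b by rewrite -[i]addn0 ri.
have zj : z j = b by rewrite -[j]addn0 rj.
have ri' : reads z u i.+1 by move=> s su; rewrite addSnnS ri.
have rj' : reads z u j.+1 by move=> s su; rewrite addSnnS rj.
have [||_] := cod i j _ _ fij; [lia|lia|].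
rewrite zi zj => /(_ erefl); rewrite oddD; case: b {ri rj zi zj} => /= h.
  by have := IH _ _ jN iN rj' ri' h; case: odd.
by have := IH _ _ iN jN ri' rj' h.
Qed.

(** The hypothesis on the sides says that f N lies between the other two values;
    an even q would carry the comparison of f (N - 2|q|) with f (N - |q|) to the
    same comparison of f (N - |q|) with f N. *)
Lemma coding_odd z q : coding N f z -> 2 * size q <= N ->
  reads z (q ++ q) (N - 2 * size q) ->
  (f (N - size q) < f N) = (f N < f (N - 2 * size q)) ->
  0 < size q ->
  odd (count_mem true q).
Proof.
move=> cod qN /reads_cat[r1 r2] side q0; apply/negPn/negP => even.
have E1 : N - 2 * size q + size q = N - size q by lia.
have E2 : N - size q + size q = N by lia.
rewrite E1 in r2.
have [|||lt|lt] := @ltn_total_inj (N - size q) (N - 2 * size q); try lia.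
  have := coding_reads cod _ _ r2 r1 lt; rewrite (negbTE even) E1 E2 => H.
  by have := H ltac:(lia) ltac:(lia); lia.
have := coding_reads cod _ _ r1 r2 lt; rewrite (negbTE even) E1 E2 => H.
by have := H ltac:(lia) ltac:(lia); lia.
Qed.

(** If q = a^m with a odd, reading a reverses the order, so f is monotone along
    the positions N - 2j|a| for j <= m.  The ends of this chain have adjacent
    values, which leaves no room for m > 1. *)
Lemma coding_primitive z q : coding N f z -> 2 * size q <= N ->
  reads z (q ++ q) (N - 2 * size q) ->
  f (N - 2 * size q) = (f N).+1 \/ (f (N - 2 * size q)).+1 = f N ->
  odd (count_mem true q) -> primitive_word q.
Proof.
move=> cod qN r adj oq [a [m [m1 qE]]].
have oa : odd (count_mem true a) by move: oq; rewrite qE count_wpower oddM => /andP[].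
have a0 : 0 < size a by case: (a) oa.
rewrite qE -wpowerD addnn size_wpower in r.
rewrite qE size_wpower in qN adj.
pose F k := f (N - k * size a).
(* F lists the values at the starts of the successive copies of a in the
   suffix a^(2m), counted from the end: reading a leads from F k to F (k - 1). *)
have F_step k l : 0 < k <= m.*2 -> 0 < l <= m.*2 -> F k < F l -> F l.-1 < F k.-1.
  case: k l => [|k] [|l] //= kN lN.
  have read_at j : j < m.*2 -> reads z a (N - j.+1 * size a).
    move=> jm; have -> : N - j.+1 * size a
        = N - 2 * (m * size a) + (m.*2 - j.+1) * size a.
      have : j.+1 * size a + (m.*2 - j.+1) * size a = 2 * (m * size a).
        by rewrite -mulnDl subnKC// -mul2n mulnA.
      move: qN; move: (j.+1 * _) ((_ - _) * _) (2 * _) => x y w; lia.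
    by apply: reads_wpower r _; lia.
  have next j : j < m.*2 -> N - j.+1 * size a + size a = N - j * size a.
    by move=> jm; have : j.+1 * size a <= m.*2 * size a; [rewrite leq_mul2r jm orbT|lia].
  move=> /(coding_reads cod _ _ (read_at _ kN) (read_at _ lN)).
  by rewrite oa !next// => -> //; lia.
have F_neq k l : k <= m.*2 -> l <= m.*2 -> k <> l -> F k < F l \/ F l < F k.
  move=> km lm kl.
  have : k * size a <= m.*2 * size a by rewrite leq_mul2r km orbT.
  have : l * size a <= m.*2 * size a by rewrite leq_mul2r lm orbT.
  move=> h1 h2; apply: ltn_total_inj; try lia.
  have kl' : k * size a <> l * size a by move/eqP; rewrite eqn_pmul2r//; lia.
  by lia.
have FN : F 0 = f N by rewrite /F subn0.
have F2m : F (m.*2) = f (N - 2 * (m * size a)) by rewrite /F -mul2n mulnA.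
have [up|down] := F_neq 0 2 ltac:(lia) ltac:(lia) ltac:(lia).
  have inc j : j < m -> F j.*2 < F j.+1.*2.
    elim: j => [//|j IH] jm; have {}IH := IH ltac:(lia).
    have [//|h] := F_neq j.+1.*2 j.+2.*2 ltac:(lia) ltac:(lia) ltac:(lia).
    have h1 := F_step j.+2.*2 j.+1.*2 ltac:(lia) ltac:(lia) h.
    have := F_step j.+1.*2.-1 j.+2.*2.-1 ltac:(lia) ltac:(lia) h1.
    rewrite !doubleS /=; rewrite !doubleS in IH; lia.
  have : forall j, j <= m -> F 0 + j <= F j.*2.
    elim=> [|j IH] jm; first by rewrite addn0.
    by have := IH (ltnW jm); have := inc j jm; lia.
  by move=> /(_ m (leqnn m)); lia.
have dec j : j < m -> F j.+1.*2 < F j.*2.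
  elim: j => [//|j IH] jm; have {}IH := IH ltac:(lia).
  have [h|//] := F_neq j.+1.*2 j.+2.*2 ltac:(lia) ltac:(lia) ltac:(lia).
  have h1 := F_step j.+1.*2 j.+2.*2 ltac:(lia) ltac:(lia) h.
  have := F_step j.+2.*2.-1 j.+1.*2.-1 ltac:(lia) ltac:(lia) h1.
  rewrite !doubleS /=; rewrite !doubleS in IH; lia.
have : forall j, j <= m -> F j.*2 + j <= F 0.
  elim=> [|j IH] jm; first by rewrite addn0.
  by have := IH (ltnW jm); have := dec j jm; lia.
by move=> /(_ m (leqnn m)); lia.
Qed.

(** Disagreements between the orders of f and g travel to the right along equal
    letters until one index is N.  There N may be replaced by the index N - |q|,
    whose value is adjacent to that of N on the same side for f and for g, and
    the travel resumes.  It can only stay within the last |q| indices by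
    bouncing between N - l and N - (|q| - l), and then the rotation of q by l
    letters is q. *)
Lemma coding_rigid g z q :
  (forall i j, i <= N -> j <= N -> g i = g j -> i = j) ->
  coding N f z -> coding N g z -> 0 < size q <= N ->
  reads z q (N - size q) -> primitive_word q ->
  f (N - size q) = (f N).+1 /\ g (N - size q) = (g N).+1 \/
  (f (N - size q)).+1 = f N /\ (g (N - size q)).+1 = g N ->
  forall i j, i <= N -> j <= N -> (f i < f j) = (g i < g j).
Proof.
move=> g_inj codf codg /andP[q0 qN] rq primq adj.
set c := size q in q0 qN rq adj *.
have f_neq i j (iN : i <= N) (jN : j <= N) : i <> j -> f i <> f j.
  by move=> ij /(f_inj iN jN).
have g_neq i j (iN : i <= N) (jN : j <= N) : i <> j -> g i <> g j.
  by move=> ij /(g_inj _ _ iN jN).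
pose dis i j := (f i < f j) != (g i < g j).
have dis_sym i j : i <= N -> j <= N -> dis i j -> dis j i.
  rewrite /dis => iN jN; have [->|/eqP ij] := eqVneq i j; first by rewrite !ltnn.
  by have := f_neq _ _ iN jN ij; have := g_neq _ _ iN jN ij; lia.
have dis_step i j : i < N -> j < N -> dis i j -> z i = z j /\ dis i.+1 j.+1.
  move=> iN jN; rewrite /dis.
  have [->|/eqP ij] := eqVneq i j; first by rewrite !ltnn.
  have := f_neq _ _ (ltnW iN) (ltnW jN) ij.
  have := g_neq _ _ (ltnW iN) (ltnW jN) ij.
  have := codf i j iN jN; have := codf j i jN iN.
  have := codg i j iN jN; have := codg j i jN iN.
  case: (ltngtP (f i) (f j)) => // _; case: (ltngtP (g i) (g j)) => //= _.
    move=> /(_ erefl)[zji +] _ _ /(_ erefl)[zij +] _ _ _.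
    have zE : z i = z j by case: (z i) (z j) zij zji => [] [].
    rewrite zE => /(_ erefl) + /(_ erefl).
    by case: (z j); split => //; lia.
  move=> _ /(_ erefl)[zij +] /(_ erefl)[zji +] _ _ _ _.
  have zE : z i = z j by case: (z i) (z j) zij zji => [] [].
  rewrite zE => /(_ erefl) + /(_ erefl).
  by case: (z j); split => //; lia.
have dis_iter t i j : i + t <= N -> j + t <= N -> dis i j ->
    (forall s, s < t -> z (i + s) = z (j + s)) /\ dis (i + t) (j + t).
  elim: t => [|t IH] it jt d; first by rewrite !addn0.
  have [zE d'] := IH ltac:(lia) ltac:(lia) d.
  have [zt d''] := dis_step (i + t) (j + t) ltac:(lia) ltac:(lia) d'.
  rewrite !addnS; split=> // s; rewrite ltnS leq_eqVlt => /orP[/eqP->//|].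
  exact: zE.
have dis_end k : k < N -> dis k N -> k <> N - c /\ dis k (N - c).
  move=> kN; rewrite /dis.
  have [->|/eqP kc] := eqVneq k (N - c); first by case: adj => -[]; lia.
  move=> d; split=> //; move: d.
  have := f_neq k (N - c) ltac:(lia) ltac:(lia) kc.
  have := g_neq k (N - c) ltac:(lia) ltac:(lia) kc.
  have := f_neq k N ltac:(lia) ltac:(lia) ltac:(lia).
  have := g_neq k N ltac:(lia) ltac:(lia) ltac:(lia).
  by case: adj => -[]; lia.
have no_dis_tail l : 0 < l < c -> ~ dis (N - l) N.
  move=> lc d; have [_ d1] := dis_end (N - l) ltac:(lia) d.
  have [z1] := dis_iter l (N - l) (N - c) ltac:(lia) ltac:(lia) d1.
  have -> : N - l + l = N by lia.
  have -> : N - c + l = N - (c - l) by lia.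
  move=> /(dis_sym _ _ (leqnn N) (leq_subr _ _)) d2.
  have [_ d3] := dis_end (N - (c - l)) ltac:(lia) d2.
  have [z2 _] := dis_iter (c - l) (N - (c - l)) (N - c) ltac:(lia) ltac:(lia) d3.
  have rot : take l q ++ drop l q = drop l q ++ take l q.
    rewrite cat_take_drop; apply: (@eq_from_nth _ false) => [|s sc].
      by rewrite size_cat size_drop size_takel -/c; lia.
    rewrite nth_cat size_drop -/c nth_drop; case: ltnP => h.
      rewrite -!rq -/c; try lia.
      by rewrite -z2; [congr z; lia|lia].
    rewrite nth_take; last by rewrite -/c in sc; lia.
    rewrite -!rq -/c; try by rewrite -/c in sc; lia.
    rewrite -[in RHS]z1; last by rewrite -/c in sc; lia.
    by congr z; rewrite -/c in sc; lia.
  apply: (commuting_not_primitive rot); last by rewrite cat_take_drop.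
    by move=> /(congr1 size); rewrite size_takel -/c /=; lia.
  by move=> /(congr1 size); rewrite size_drop -/c /=; lia.
have no_dis_end k : k < N -> ~ dis k N.
  have [b] := ubnP (N - k); elim: b k => // b IH k kb kN d.
  have [kc d1] := dis_end k kN d.
  have [lt|ge] := ltnP k (N - c).
    have [_] := dis_iter c k (N - c) ltac:(lia) ltac:(lia) d1.
    by rewrite subnK//; apply: IH; lia.
  apply: (no_dis_tail (N - k)); first by lia.
  by rewrite subKn// ltnW.
have no_dis i j : i <= j -> j <= N -> ~ dis i j.
  move=> ij jN d; have [_] := dis_iter (N - j) i j ltac:(lia) ltac:(lia) d.
  rewrite subnKC//; have [->|] := eqVneq i j; first by rewrite subnKC// /dis !ltnn.
  by move=> /eqP ? ; apply: no_dis_end; lia.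
move=> i j iN jN; have [//|d] := eqVneq (f i < f j) (g i < g j).
case/orP: (leq_total i j) => h; first by case: (no_dis i j).
by case: (no_dis j i) => //; apply: dis_sym.
Qed.

End Coding.

(** * Permutations, marked cycles and segmentations *)

Lemma sorted_pmap_nth (r : rel nat) (s : seq (option nat)) : transitive r ->
  sorted r (pmap id s) <->
  (forall i j a b, i < j -> nth None s i = Some a -> nth None s j = Some b -> r a b).
Proof.
move=> r_tr; rewrite sorted_pairwise//; elim: s => [|x s IH] /=.
  by split=> // _ i j a b _; rewrite nth_nil.
have step : (forall i j a b, i < j -> nth None (x :: s) i = Some a ->
      nth None (x :: s) j = Some b -> r a b) <->
    (forall a b, x = Some a -> b \in pmap id s -> r a b) /\
    (forall i j a b, i < j -> nth None s i = Some a -> nth None s j = Some b -> r a b).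
  split=> [H|[H1 H2] [|i] [|j] a b //= ij ha hb].
    split=> [a b xa|i j a b ij ha hb]; last exact: (H i.+1 j.+1).
    rewrite mem_pmap map_id => /(nthP None)[j js hb]; exact: (H 0 j.+1).
  - apply: H1 ha _; rewrite mem_pmap map_id -hb mem_nth// ltnNge.
    by apply/negP => h; rewrite nth_default in hb.
  - exact: (H2 i j).
rewrite step; case: x {step} => [a|] /=; last by rewrite IH; split=> [|[]//].
split=> [/andP[/allP H /IH]|[H /IH->]]; last by rewrite andbT; apply/allP => b /H; apply.
by split=> // _ b [<-]; apply: H.
Qed.

(** Positions are counted from 0 here, so that the letter z_(i+1) of a prefix and
    the value pi_(i+1) sit at the same index i, as in [coding]. *)
Definition value n (pi : 'S_n) (i : nat) : nat := entry pi i.+1.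

Lemma valueE n (pi : 'S_n) (k : 'I_n) : value pi k = (pi k).+1.
Proof. by rewrite /value /entry /oneline /= (nth_map k) ?size_enum_ord// nth_ord_enum. Qed.

(** The value of a permutation at k is the number of smaller values. *)
Lemma perm_ltn_inj n (pi pi' : 'S_n) :
  (forall i j, (pi i < pi j) = (pi' i < pi' j)) -> pi = pi'.
Proof.
have rank (s : 'S_n) (k : 'I_n) : (s k : nat) = #|[set j | s j < s k]|.
  rewrite -[[set j | _]](_ : s @^-1: [set v : 'I_n | v < s k] = _); last first.
    by apply/setP => j; rewrite !inE.
  rewrite card_preimset; last exact: perm_inj.
  rewrite -[LHS]card_ord -!sum1_card (big_ord_widen n (fun=> 1) (ltnW (ltn_ord (s k)))).
  by apply: eq_bigl => v; rewrite inE.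
move=> H; apply/permP => k; apply: val_inj; rewrite /= [LHS]rank [RHS]rank.
by apply: eq_card => j; rewrite !inE H.
Qed.

Section Marked.
Variables (N : nat) (pi : 'S_N.+1).
Notation f := (value pi).

Lemma value_bound i : i <= N -> 0 < f i <= N.+1.
Proof.
by move=> iN; rewrite -[i]/(nat_of_ord (Ordinal (iN : i < N.+1))) valueE ltn_ord.
Qed.

Lemma value_inj i j : i <= N -> j <= N -> f i = f j -> i = j.
Proof.
move=> iN jN; rewrite -[i]/(nat_of_ord (Ordinal (iN : i < N.+1))).
rewrite -[j]/(nat_of_ord (Ordinal (jN : j < N.+1))) !valueE.
by move=> -[/val_inj/perm_inj] ->.
Qed.

Lemma value_surj v : 0 < v <= N.+1 -> exists2 i, i <= N & f i = v.
Proof.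
case: v => // v vN; exists (pi^-1%g (Ordinal (vN : v < N.+1))); first by rewrite -ltnS.
by rewrite valueE permKV.
Qed.

Lemma size_oneline : size (oneline pi) = N.+1.
Proof. by rewrite size_map size_enum_ord. Qed.

Lemma uniq_oneline : uniq (oneline pi).
Proof.
rewrite map_inj_uniq ?enum_uniq// => i j [/val_inj]; exact: perm_inj.
Qed.

Lemma position_value i : i <= N -> position pi (f i) = i.+1.
Proof. by move=> iN; rewrite /position index_uniq ?size_oneline ?uniq_oneline. Qed.

Lemma nth_marked_cycle i : i <= N ->
  nth None (marked_cycle pi) (f i).-1 = if i < N then Some (f i.+1) else None.
Proof.
move=> iN; have /andP[f0 fN] := value_bound iN.
rewrite (nth_map 0) ?size_iota ?nth_iota ?add1n ?prednK//.
by rewrite position_value// ltnS.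
Qed.

Lemma nth_marked_cycle_Some v a : nth None (marked_cycle pi) v = Some a ->
  exists i, [/\ i < N, f i = v.+1 & a = f i.+1].
Proof.
move=> h; have vN : v < N.+1.
  by rewrite ltnNge; apply/negP => H; rewrite nth_default ?size_map ?size_iota in h.
have [i iN fi] := value_surj (v := v.+1) vN.
move: h; rewrite -[v]/(v.+1.-1) -fi nth_marked_cycle//.
by case: ifP => // iN' [<-]; exists i; rewrite fi.
Qed.

Lemma increasing_blockE e : increasing_block (take e (marked_cycle pi)) <->
  (forall i j, i < N -> j < N -> f i < f j -> f j <= e -> f i.+1 < f j.+1).
Proof.
rewrite /increasing_block sorted_pmap_nth; last exact: ltn_trans.
split=> H.
  move=> i j iN jN fij fj.
  have fi0 := value_bound (ltnW iN); have fj0 := value_bound (ltnW jN).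
  apply: (H (f i).-1 (f j).-1); first by lia.
    by rewrite nth_take ?nth_marked_cycle ?iN//; [exact: ltnW|lia].
  by rewrite nth_take ?nth_marked_cycle ?jN//; [exact: ltnW|lia].
move=> v1 v2 a b v12; have [v2e|ev2] := ltnP v2 e; last first.
  by move=> _; rewrite nth_default// size_take; case: ltnP; lia.
rewrite !nth_take//; last by apply: ltn_trans v2e.
move=> /nth_marked_cycle_Some[i [iN fi ->]] /nth_marked_cycle_Some[j [jN fj ->]].
by apply: H; rewrite ?fi ?fj.
Qed.

Lemma decreasing_blockE e : decreasing_block (drop e (marked_cycle pi)) <->
  (forall i j, i < N -> j < N -> f i < f j -> e < f i -> f j.+1 < f i.+1).
Proof.
rewrite /decreasing_block sorted_pmap_nth; last by move=> x y z /= h1 h2; apply: ltn_trans h2 h1.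
split=> H.
  move=> i j iN jN fij fi.
  have fj0 := value_bound (ltnW jN).
  apply: (H ((f i).-1 - e) ((f j).-1 - e)); first by lia.
    by rewrite nth_drop subnKC ?nth_marked_cycle ?iN//; [exact: ltnW|lia].
  by rewrite nth_drop subnKC ?nth_marked_cycle ?jN//; [exact: ltnW|lia].
move=> v1 v2 a b v12; rewrite !nth_drop.
move=> /nth_marked_cycle_Some[i [iN fi ->]] /nth_marked_cycle_Some[j [jN fj ->]].
by apply: H; rewrite ?fi ?fj//; lia.
Qed.

Lemma blocks_coding e :
  increasing_block (take e (marked_cycle pi)) /\
  decreasing_block (drop e (marked_cycle pi)) <->
  coding N f (fun i => e < f i).
Proof.
rewrite increasing_blockE decreasing_blockE; split=> [[inc dec]|cod].
  move=> i j iN jN fij; split; first by lia.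
  by case: ltnP => ei fji; [apply: dec | apply: inc => //; lia].
split=> i j iN jN fij h; have [_] := cod i j iN jN fij.
  have -> : (e < f i) = false by lia.
  have -> : (e < f j) = false by lia.
  by move=> /(_ erefl).
have -> : (e < f i) = true by lia.
have -> : (e < f j) = true by lia.
by move=> /(_ erefl).
Qed.

Lemma segmentationE (e0 e1 e2 : 'I_N.+2) : segmentation pi (e0, e1, e2) <->
  [/\ e0 = ord0, e2 = ord_max, coding N f (fun i => e1 < f i),
      (entry pi N == 2) && (f N == 1) ==> (e1 == 0 :> nat) &
      e1 != f N :> nat].
Proof.
rewrite /segmentation; split.
  case/and5P=> e00 _ _ e2n /and4P[inc dec no21 e1n].
  by split=> //; [exact/val_inj/eqP | exact/val_inj/eqP | exact/blocks_coding].
case=> -> -> /blocks_coding[-> ->] no21 e1n; apply/and5P; split=> //.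
  by rewrite -ltnS ltn_ord.
exact/and4P.
Qed.

Lemma card_segmentation_le2 : #|[set E | segmentation pi E]| <= 2.
Proof.
rewrite leqNgt; apply/negP => /card_gt2P[E1 [E2 [E3 [[]]]]].
rewrite !inE => s1 s2 s3 [].
case: E1 s1 => [[a0 a] a2] /segmentationE[-> -> ca _ /eqP an].
case: E2 s2 => [[b0 b] b2] /segmentationE[-> -> cb _ /eqP bn].
case: E3 s3 => [[c0 c] c2] /segmentationE[-> -> cc _ /eqP cn].
rewrite !xpair_eqE !eqxx !andbT /= => ab bc ac.
have no3 (x y z : 'I_N.+2) : x < y -> y < z -> y <> f N :> nat ->
    z <> f N :> nat -> coding N f (fun i => x < f i) ->
    coding N f (fun i => z < f i) -> False.
  move=> xy yz yn zn cx cz.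
  by apply: (no_three_cuts value_surj xy yz _ yn zn cx cz); rewrite -ltnS.
have := no3 a b c; have := no3 a c b; have := no3 b a c.
have := no3 b c a; have := no3 c a b; have := no3 c b a.
have {}ab : (a : nat) <> b by move=> /val_inj E; rewrite E eqxx in ab.
have {}bc : (b : nat) <> c by move=> /val_inj E; rewrite E eqxx in bc.
have {}ac : (c : nat) <> a by move=> /val_inj E; rewrite E eqxx in ac.
by case: (ltngtP a b) (ltngtP b c) (ltngtP c a) => [?|?|?] [?|?|?] [?|?|?]; intuition.
Qed.

End Marked.

(** * Permutations induced by the shift *)

Lemma iter_shift2 i (w : word2) k : iter i shift2 w k = w (i + k).
Proof. by elim: i k => [//|i IH] k /=; rewrite /shift2 IH addnS. Qed.

Lemma tent_lt_head v w : tent_lt v w -> v 0 <= w 0.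
Proof.
case=> [[|j] [vw]]; last by move=> _ _; rewrite vw.
by rewrite big_ord0 /= => _; apply: ltnW.
Qed.

Lemma tent_lt_shift v w : tent_lt v w -> v 0 = w 0 ->
  if v 0 then tent_lt (shift2 w) (shift2 v) else tent_lt (shift2 v) (shift2 w).
Proof.
case=> [[|j] [vw vwj lt]] // v0.
have vw' i : i < j -> shift2 v i = shift2 w i by exact: (vw i.+1).
have sumE : \sum_(i < j.+1) v i = v 0 + \sum_(i < j) shift2 v i.
  by rewrite big_ord_recl.
rewrite sumE oddD in lt; case: (v 0) lt => /= lt; exists j; split=> //.
- by move=> i /vw'.
- by move=> /esym.
rewrite (eq_bigr (fun i : 'I_j => shift2 v i : nat)) => [|i _]; last by rewrite vw'.
by case: odd lt.
Qed.

(** The words v and 0v agree only as long as v has letters 0, so v is the larger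
    one where they part. *)
Lemma tent_lt_shift_id v : v 0 = false -> ~ tent_lt (shift2 v) v.
Proof.
move=> v0 [j [same diff]].
have v_false i : i <= j -> v i = false.
  by elim: i => [//|i IH] ij; rewrite -[v i.+1]/(shift2 v i) same// IH// ltnW.
rewrite big1 /=; last by move=> i _; rewrite same ?v_false// ltnW.
by rewrite v_false.
Qed.

Section Allowed.
Variables (N : nat) (pi : 'S_N.+1).
Notation f := (value pi).

Lemma allowed_word : allowed pi -> exists w : word2,
  forall i j, i <= N -> j <= N -> tent_lt (iter i shift2 w) (iter j shift2 w) <-> f i < f j.
Proof.
case=> w [_ H]; exists w => i j.
move=> iN jN; rewrite -[i]/(nat_of_ord (Ordinal (iN : i < N.+1))).
rewrite -[j]/(nat_of_ord (Ordinal (jN : j < N.+1))) H !valueE.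
by rewrite ltnS.
Qed.

Variable w : word2.
Hypothesis w_pi : forall i j, i <= N -> j <= N ->
  tent_lt (iter i shift2 w) (iter j shift2 w) <-> f i < f j.

Lemma word_le i j : i <= N -> j <= N -> f i < f j -> w i <= w j.
Proof.
by move=> iN jN /(w_pi iN jN)/tent_lt_head; rewrite !iter_shift2 !addn0.
Qed.

Lemma word_coding : coding N f w.
Proof.
move=> i j iN jN fij; split; first exact: word_le (ltnW iN) (ltnW jN) fij.
move=> wij; have /(w_pi (ltnW iN) (ltnW jN))/tent_lt_shift := fij.
rewrite !iter_shift2 !addn0 => /(_ wij).
by case: (w i) => /(w_pi (i := _.+1) (j := _.+1)); apply.
Qed.

Lemma word_cut : exists e, coding N f (fun i => e < f i).
Proof.
exists (\max_(k : 'I_N.+1 | ~~ w k) f k).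
apply: eq_coding word_coding => i iN; apply/idP/idP => [wi|].
  have i0 := value_bound pi (ltnW iN).
  rewrite -(ltn_predK (n := f i) (m := 0)) ?ltnS; last by lia.
  apply/bigmax_leqP => k wk; have kN : k <= N by rewrite -ltnS.
  have [|h|h] := ltn_total_inj (@value_inj N pi) kN (ltnW iN).
  - by move=> E; rewrite E wi in wk.
  - by move: h => /=; lia.
  - by have := word_le (ltnW iN) kN h; rewrite wi (negbTE wk).
apply: contraLR => wi; rewrite -leqNgt.
exact: (@leq_bigmax_cond _ (fun k : 'I_N.+1 => ~~ w k) (fun k => f k) (Ordinal (ltnW iN : i < N.+1))).
Qed.

(** By [tent_lt_shift_id], w has a letter 1 where pi takes the value 2.  Every
    larger value then also sits at a letter 1, so the step from the index N - 2,
    which leads to the value 2, ends below the step from N - 1, which leads to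
    the value 1. *)
Lemma word_not21 : 1 < N -> ~~ ((entry pi N == 2) && (f N == 1)).
Proof.
move=> N1; apply/negP => /andP[/eqP e2 /eqP e1].
have fN1 : f N.-1 = 2 by rewrite /value prednK// ltnW.
have lt1 : f N < f N.-1 by rewrite e1 fN1.
have /(w_pi (leqnn N) (leq_pred N)) lt1w := lt1.
have [w1|/negbTE w0] := boolP (w N.-1); last first.
  apply: (@tent_lt_shift_id (iter N.-1 shift2 w)).
    by rewrite iter_shift2 addn0.
  by rewrite -[shift2 _]/(iter N.-1.+1 shift2 w) prednK// ltnW.
have lt2 : f N.-1 < f N.-2.
  have := value_bound pi (i := N.-2) ltac:(lia).
  have := @value_inj N pi N.-2 N ltac:(lia) (leqnn N).
  have := @value_inj N pi N.-2 N.-1 ltac:(lia) ltac:(lia).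
  by rewrite e1 fN1; lia.
have [] := word_coding _ _ lt2; [lia|lia|].
rewrite w1; case: (w N.-2) => // _ /(_ erefl).
by rewrite !prednK ?e1//; have := value_bound pi (i := N.-1) ltac:(lia); lia.
Qed.

End Allowed.

Lemma card_segmentation_allowed N (pi : 'S_N.+1) : 1 < N -> allowed pi ->
  #|[set E | segmentation pi E]| = 2.
Proof.
move=> N1 /allowed_word[w w_pi]; apply/eqP.
rewrite eqn_leq card_segmentation_le2 /=; apply/card_gt1P.
have [e cod_e] := word_cut w_pi; have not21 := word_not21 w_pi N1.
have [i0 _ max] : {i0 : 'I_N | true & forall i : 'I_N, value pi i.+1 <= value pi i0.+1}.
  case: (arg_maxnP (P := xpredT) (i0 := Ordinal (ltnW N1)) (fun i : 'I_N => value pi i.+1) isT).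
  by move=> i0 _ H; exists i0 => // i; apply: H.
have max' i : i < N -> value pi i.+1 <= value pi i0.+1.
  by move=> iN; apply: (max (Ordinal iN)).
have i0N : i0 < N by [].
have peak := coding_cut_peak (@value_inj N pi) cod_e i0N max'.
have f_i0 := value_bound pi (ltnW i0N); have f_N := value_bound pi (leqnn N).
have f_neqN i : i < N -> value pi i <> value pi N.
  by move=> iN /(value_inj (ltnW iN) (leqnn N)); lia.
(* The peak value c is the last one below the cut c and the first one above
   the cut c'; if c - 1 is the last value, where the star stands, c' is moved
   past it. *)
pose c := value pi i0.
pose c' := if c.-1 == value pi N then c.-2 else c.-1.
have c'_lt : c' < c by rewrite /c' /c; case: eqP; lia.
have c'_neq : c' != value pi N by rewrite /c' /c; case: ifPn; lia.
have c_cut : coding N (value pi) (fun i => c < value pi i) by apply: peak; left.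
have c'_cut : coding N (value pi) (fun i => c' < value pi i).
  apply: peak; right; split=> // i iN.
  by have := f_neqN i iN; rewrite /c' -/c; case: eqP; lia.
have seg x : x <= N.+1 -> x != value pi N -> coding N (value pi) (fun i => x < value pi i) ->
    (ord0, inord x, ord_max) \in [set E | segmentation pi E].
  move=> xN xf cod; rewrite inE; apply/segmentationE.
  by rewrite inordK// (negbTE not21).
have cN : c <= N.+1 by case/andP: f_i0.
have c_neq : c != value pi N by apply/eqP/f_neqN.
exists (ord0, inord c, ord_max), (ord0, inord c', ord_max); split.
- exact: seg.
- by apply: seg => //; lia.
by apply/eqP => -[/(congr1 val)] /=; rewrite !inordK; lia.
Qed.

(** * Invalid segmentations *)

Section Invalid.
Variable N : nat.
Implicit Types (pi : 'S_N.+1) (E : segm N.+1).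

Lemma size_zeta pi E : size (zeta pi E) = N.
Proof. by case: E => [[e0 e1] e2]; rewrite size_map size_iota. Qed.

Lemma nth_zeta pi (e0 e1 e2 : 'I_N.+2) i : i < N ->
  nth false (zeta pi (e0, e1, e2)) i = (e1 < value pi i).
Proof. by move=> iN; rewrite (nth_map 0) ?size_iota// nth_iota// add1n. Qed.

(** In the notation of [invalid], b is true if q = p^2 and false if p = q^2; the
    shorter of the two words has length c. *)
Definition square_suffix pi E (b : bool) (c : nat) : bool :=
  (drop (N - 2 * c) (zeta pi E)
     == drop (N - c) (zeta pi E) ++ drop (N - c) (zeta pi E)) &&
  (if b then (value pi (N - c) == (value pi N).+1)
             && ((value pi (N - 2 * c)).+1 == value pi N)
   else ((value pi (N - c)).+1 == value pi N)
        && (value pi (N - 2 * c) == (value pi N).+1)).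

Lemma invalid_square_suffix pi E : invalid pi E ->
  exists b c, [/\ 0 < c, 2 * c <= N & square_suffix pi E b c].
Proof.
have fN := value_bound pi (leqnn N).
rewrite /invalid -/(value pi N) => /and3P[f1 fn].
have [|x xN fx] := @value_surj N pi (value pi N).+1; first by lia.
have [|y yN fy] := @value_surj N pi (value pi N).-1; first by lia.
have {}xN : x < N.
  by rewrite ltn_neqAle xN andbT; apply/eqP => xE; move: fx; rewrite xE; lia.
have {}yN : y < N.
  by rewrite ltn_neqAle yN andbT; apply/eqP => yE; move: fy; rewrite yE; lia.
rewrite -fx -fy !position_value; try exact: ltnW.
rewrite /zeta_from /wpower /= !cats0 => /orP[] /eqP sq.
  have := congr1 size sq; rewrite size_cat !size_drop size_zeta => szE.
  exists false, (N - y); split; [lia|lia|].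
  have xE : N - 2 * (N - y) = x by lia.
  by rewrite /square_suffix xE subKn ?sq ?eqxx ?fx ?fy /=; lia.
have := congr1 size sq; rewrite size_cat !size_drop size_zeta => szE.
exists true, (N - x); split; [lia|lia|].
have yE : N - 2 * (N - x) = y by lia.
by rewrite /square_suffix yE subKn ?sq ?eqxx ?fx ?fy /=; lia.
Qed.

Lemma zeta_suffix_facts pi (e0 e1 e2 : 'I_N.+2) b c q :
  segmentation pi (e0, e1, e2) -> 0 < c -> 2 * c <= N ->
  square_suffix pi (e0, e1, e2) b c ->
  q = drop (N - c) (zeta pi (e0, e1, e2)) ->
  [/\ size q = c, reads (fun i => e1 < value pi i) q (N - c),
      odd (count_mem true q) & primitive_word q].
Proof.
move=> /segmentationE[_ _ cod _ _] c0 cN /andP[/eqP sq adj] qE.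
have szq : size q = c by rewrite qE size_drop size_zeta; lia.
have rq : reads (fun i => e1 < value pi i) q (N - c).
  by move=> s; rewrite szq qE nth_drop => sc; rewrite nth_zeta//; lia.
have rqq : reads (fun i => e1 < value pi i) (q ++ q) (N - 2 * size q).
  rewrite szq qE -sq => s; rewrite size_drop size_zeta => sc.
  by rewrite nth_drop nth_zeta//; lia.
have odd_q : odd (count_mem true q).
  by apply: (coding_odd (@value_inj N pi) cod _ rqq); rewrite szq//; case: b adj; lia.
split=> //; apply: (coding_primitive (@value_inj N pi) cod _ rqq) => //.
  by rewrite szq.
by rewrite szq; case: b adj => /andP[/eqP h1 /eqP h2]; [right|left].
Qed.

(** The permutation is determined by [coding_rigid]; two cuts that separate the
    values pi_1, ..., pi_(n-1) in the same way can differ only by passing pi_n,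
    and then one of them is equal to it. *)
Lemma square_suffix_inj pi E pi' E' b c :
  segmentation pi E -> segmentation pi' E' -> 0 < c -> 2 * c <= N ->
  square_suffix pi E b c -> square_suffix pi' E' b c ->
  zeta pi E = zeta pi' E' -> (pi, E) = (pi', E').
Proof.
case: E E' => [[e0 e1] e2] [[e0' e1'] e2'] seg seg' c0 cN sq sq' zE.
have [szq rq _ prim] := zeta_suffix_facts seg c0 cN sq erefl.
set q := drop _ _ in szq rq prim.
have /segmentationE[-> -> cod _ /eqP e1N] := seg.
have /segmentationE[-> -> cod' _ /eqP e1N'] := seg'.
have zE' i : i < N -> (e1' < value pi' i) = (e1 < value pi i).
  by move=> iN; rewrite -(nth_zeta pi' e0' e1' e2' iN) -zE nth_zeta.
have ltE : forall i j, i <= N -> j <= N ->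
    (value pi i < value pi j) = (value pi' i < value pi' j).
  apply: (coding_rigid (q := q) (@value_inj N pi) (@value_inj N pi') cod).
  - exact: eq_coding zE' cod'.
  - by rewrite szq; lia.
  - by rewrite szq.
  - exact: prim.
  rewrite szq; move: sq sq' => /andP[_ +] /andP[_].
  by case: (b) => /andP[/eqP-> _] /andP[/eqP-> _]; [left|right].
have piE : pi = pi'.
  apply: perm_ltn_inj => i j; have := ltE i j; rewrite !valueE !ltnS.
  by apply; rewrite -ltnS.
subst pi'; congr (_, (_, _, _)); apply: val_inj => /=.
have no_gap (x y : 'I_N.+2) : x < y -> y <> value pi N :> nat ->
    (forall i, i < N -> (x < value pi i) = (y < value pi i)) -> False.
  move=> xy yN H; have [|i iN fi] := @value_surj N pi y; first by have := ltn_ord y; lia.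
  have iN' : i < N by rewrite ltn_neqAle iN andbT; apply/eqP => iE; apply: yN; rewrite -fi iE.
  by have := H i iN'; rewrite fi; lia.
case: (ltngtP e1 e1') => // lt.
  by case: (no_gap _ _ lt e1N') => i /zE'.
by case: (no_gap _ _ lt e1N) => i /zE'->.
Qed.

(** A prefix with this suffix is given by its first N - 2c letters and by q. *)
Lemma card_square_suffix b c : 0 < c -> 2 * c <= N ->
  #|[set x : 'S_N.+1 * segm N.+1 | segmentation x.1 x.2 & square_suffix x.1 x.2 b c]|
    <= 2 ^ (N - 2 * c) * psi_odd c.
Proof.
move=> c0 cN; set A := [set x | _ & _].
pose phi (x : 'S_N.+1 * segm N.+1) : (N - 2 * c).-tuple bool * c.-tuple bool :=
  ([tuple nth false (zeta x.1 x.2) i | i < N - 2 * c],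
   [tuple nth false (zeta x.1 x.2) (N - c + i) | i < c]).
have tvalE x : tval (phi x).2 = drop (N - c) (zeta x.1 x.2).
  apply: (@eq_from_nth _ false) => [|i].
    by rewrite size_tuple size_drop size_zeta; lia.
  rewrite size_tuple => ic; rewrite nth_drop.
  by rewrite -[i]/(nat_of_ord (Ordinal ic)) -tnth_nth tnth_mktuple.
have phi_inj : {in A &, injective phi}.
  move=> [pi E] [pi' E']; rewrite !inE /= => /andP[seg sq] /andP[seg' sq'] phiE.
  apply: (square_suffix_inj seg seg' c0 cN sq sq').
  have suffE := congr1 (fun t => tval t.2) phiE; rewrite !tvalE /= in suffE.
  have prefE i : i < N - 2 * c -> nth false (zeta pi E) i = nth false (zeta pi' E') i.
    move=> ic; have := congr1 (fun t => tnth t.1 (Ordinal ic)) phiE.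
    by rewrite !tnth_mktuple.
  move: sq sq' => /andP[/eqP sq _] /andP[/eqP sq' _].
  rewrite -(cat_take_drop (N - 2 * c) (zeta pi E)) -(cat_take_drop (N - 2 * c) (zeta pi' E')).
  rewrite sq sq' suffE; congr (_ ++ _); apply: (@eq_from_nth _ false) => [|i].
    by rewrite !size_take !size_zeta.
  rewrite size_take size_zeta => ic; have {}ic : i < N - 2 * c by case: ifP ic; lia.
  by rewrite !nth_take// prefE.
rewrite -(card_in_imset phi_inj).
rewrite -[X in _ <= X * _](_ : #|[set: (N - 2 * c).-tuple bool]| = _); last first.
  by rewrite cardsT card_tuple card_bool.
rewrite /psi_odd -cardsX; apply: subset_leq_card.
apply/subsetP => _ /imsetP[[pi E] + ->]; rewrite inE => /andP[seg sq].
rewrite in_setX in_setT inE tvalE /=.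
case: E seg sq => [[e0 e1] e2] seg sq.
have [_ _ -> prim] := zeta_suffix_facts seg c0 cN sq erefl.
by rewrite andbT; apply/asboolP.
Qed.

End Invalid.

Lemma card_bigcup_le (I : finType) (T : finType) (P : pred I) (F : I -> {set T}) :
  #|\bigcup_(i | P i) F i| <= \sum_(i | P i) #|F i|.
Proof.
elim/big_rec2: _ => [|i m A _ IH]; first by rewrite cards0.
by apply: leq_trans (leq_card_setU _ _) _; rewrite leq_add2l.
Qed.

Lemma card_invalid N :
  #|[set x : 'S_N.+1 * segm N.+1 | segmentation x.1 x.2 & invalid x.1 x.2]|
    <= 2 * \sum_(1 <= c < (N %/ 2).+1) 2 ^ (N - 2 * c) * psi_odd c.
Proof.
pose B b (c : nat) := [set x : 'S_N.+1 * segm N.+1 |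
  segmentation x.1 x.2 & square_suffix x.1 x.2 b c].
have sub : [set x : 'S_N.+1 * segm N.+1 | segmentation x.1 x.2 & invalid x.1 x.2]
    \subset \bigcup_(c < (N %/ 2).+1 | 0 < c) (B true c :|: B false c).
  apply/subsetP => -[pi E]; rewrite inE => /andP[seg /invalid_square_suffix[b [c [c0 cN sq]]]].
  have cN' : c < (N %/ 2).+1 by rewrite ltnS leq_divRL// mulnC.
  apply/bigcupP; exists (Ordinal cN') => //; rewrite !inE seg /=.
  by case: b sq => /= ->; rewrite ?orbT.
apply: leq_trans (subset_leq_card sub) _.
apply: leq_trans (card_bigcup_le _ _) _.
rewrite big_geq_mkord big_distrr /=; apply: leq_sum => c c0.
have cN : 2 * c <= N by have := ltn_ord c; rewrite ltnS leq_divRL// mulnC.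
apply: leq_trans (leq_card_setU _ _) _.
by rewrite mul2n -addnn leq_add// card_square_suffix.
Qed.

Lemma card_allowed_segmentations N : 1 < N ->
  #|[set x : 'S_N.+1 * segm N.+1 | x.1 \in Allow N.+1 & segmentation x.1 x.2]|
    = 2 * #|Allow N.+1|.
Proof.
move=> N1; rewrite mulnC -sum_nat_const -sum1_card.
rewrite (eq_bigl (fun x => (x.1 \in Allow N.+1) && segmentation x.1 x.2)); last first.
  by move=> x; rewrite inE.
rewrite -(pair_big_dep (fun pi => pi \in Allow N.+1) (fun pi E => segmentation pi E) (fun _ _ => 1)) /=.
apply: eq_bigr => pi; rewrite inE => /asboolP al.
rewrite -(card_segmentation_allowed N1 al) -sum1_card; apply: eq_bigl => E.
by rewrite inE.
Qed.

Lemma allowed_segmentations_split N : 1 < N ->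
  I_ N.+1 + #|[set x : 'S_N.+1 * segm N.+1 |
                x.1 \in Allow N.+1 & segmentation x.1 x.2 && invalid x.1 x.2]|
    = 2 * #|Allow N.+1|.
Proof.
move=> N1; rewrite -card_allowed_segmentations//.
rewrite -[RHS](cardsID [set x : 'S_N.+1 * segm N.+1 | invalid x.1 x.2]) addnC.
rewrite /I_; congr (_ + _); apply: eq_card => -[pi E]; rewrite !inE /valid_segmentation /=.
  by rewrite -andbA.
by rewrite andbA andbC.
Qed.

Local Open Scope ring_scope.
Import Order.TTheory GRing.Theory Num.Theory.

Theorem theorem7p1 (n : nat) (hn : (3 <= n)%N) :
  (I_ n)%:R / 2%:R <= (#|Allow n|)%:R :> rat /\
  (#|Allow n|)%:R <=
    (I_ n)%:R / 2%:R
    + \sum_(1 <= c < ((n - 1) %/ 2).+1)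
        2%:R ^+ (n - 2 * c - 1) * (psi_odd c)%:R :> rat.
Proof.
case: n hn => // N N2; have cardE := allowed_segmentations_split N2.
have inv_le : (#|[set x : 'S_N.+1 * segm N.+1 | x.1 \in Allow N.+1
    & segmentation x.1 x.2 && invalid x.1 x.2]|
    <= 2 * \sum_(1 <= c < (N %/ 2).+1) 2 ^ (N - 2 * c) * psi_odd c)%N.
  apply: leq_trans (card_invalid N); apply/subset_leq_card/subsetP => x.
  by rewrite !inE => /andP[].
have -> : \sum_(1 <= c < ((N.+1 - 1) %/ 2).+1)
      2%:R ^+ (N.+1 - 2 * c - 1) * (psi_odd c)%:R
    = (\sum_(1 <= c < (N %/ 2).+1) 2 ^ (N - 2 * c) * psi_odd c)%N%:R :> rat.
  rewrite natr_sum subn1; apply: eq_bigr => c _; rewrite natrM natrX.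
  by congr (_ ^+ _ * _); rewrite -subnDA addn1 subSS.
rewrite ler_pdivrMr// -lerBlDl; split.
  by rewrite -natrM ler_nat mulnC -cardE leq_addr.
rewrite -(ler_pM2r (x := 2%:R))// mulrBl divfK// lerBlDl -!natrM -natrD ler_nat.
by rewrite mulnC -cardE leq_add2l mulnC.
Qed.
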